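(* Let $F$ be a probability distribution on $[0,\infty)$ with mean $\mu$. Denote $h(x)=F(x,x+1]$ and $q(x)=h(x)/\overline{F}(x)$. Suppose $F\in\mathscr{L}_{\Delta(t)}$ for all $t\in(0,\infty)$, $\mu<\infty$, $F\in\mathscr{S}^{*}$, $\overline{F}^2(x/2)=o(F(x,x+1])$ as $x\to\infty$, and for all $y>0$, $$\limsup_{x\to\infty}\frac{q(xy)}{q(x)}<\infty .$$ Then $F\in\mathscr{S}_2$.
   Context: For a distribution $F$ on $[0,\infty)$: $\overline{F}(x)=1-F(x)$, $\overline{F}^2(x)=(\overline{F}(x))^2$, $F(a,b]=F(b)-F(a)$, and $F^{n*}=F^{*n}$ is the $n$-fold convolution of $F$. For $t\in(0,\infty)$ put $\Delta(t)=(0,t]$ and $F(x+\Delta(t))=F(x,x+t]$. $a(x)\sim b(x)$ means $\lim_{x\to\infty}a(x)/b(x)=1$; $a(x)=o(b(x))$ means $\lim_{x\to\infty}a(x)/b(x)=0$. $F\in\mathscr{S}^{*}$ if $\int_0^x\overline{F}(y)\overline{F}(x-y)\,dy\sim 2\mu\overline{F}(x)$ as $x\to\infty$. $F\in\mathscr{L}_{\Delta(t)}$ (local long-tailed) if $F(x+y+\Delta(t))\sim F(x+\Delta(t))$ as $x\to\infty$, uniformly in $y\in[0,1]$. $F\in\mathscr{S}_{\Delta(t)}$ (local subexponential) if $F\in\mathscr{L}_{\Delta(t)}$ and $F^{*2}(x+\Delta(t))\sim 2F(x+\Delta(t))$ as $x\to\infty$. $F\in\mathscr{S}_2$ (second order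 subexponential) if $F$ is a distribution on $[0,\infty)$ with finite mean $\mu$, $F\in\mathscr{S}_{\Delta(t)}$ for all $t\in(0,\infty)$, and $\overline{F^{2*}}(x)-2\overline{F}(x)\sim 2\mu F(x,x+1]$ as $x\to\infty$. *)

(* Defs.v *)
From HB Require Import structures.
From mathcomp Require Export all_boot all_order all_algebra.
From mathcomp Require Export all_classical all_reals all_analysis.
From mathcomp Require Export measurable_realfun.
Export numFieldNormedType.Exports.
Export Order.TTheory GRing.Theory Num.Theory.

Set Implicit Arguments.
Unset Strict Implicit.
Unset Printing Implicit Defensive.

Local Open Scope classical_set_scope.
Local Open Scope ring_scope.

(** Asymptotics as [x] tends to [+oo], as limits of quotients.  Since
    [a / 0 = 0], [asymp_eq a b] forces [b] to be eventually nonzero, whereas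
    [asymp_o a b] only has its usual meaning if [b] is eventually nonzero. *)
Definition asymp_eq (R : realType) (a b : R -> R) : Prop :=
  a x / b x @[x --> +oo] --> (1 : R).

Definition asymp_o (R : realType) (a b : R -> R) : Prop :=
  a x / b x @[x --> +oo] --> (0 : R).

(** A distribution is a Borel probability measure on the line; its distribution
    function is the [cdf] of the identity, seen as a random variable on the
    line equipped with that measure. *)
Definition id_rv (R : realType) : measurableTypeR R -> R := idfun.

HB.instance Definition _ (R : realType) :=
  @isMeasurableFun.Build _ _ _ _ (@id_rv R) (@measurable_id _ _ setT).

Definition sum_rv (R : realType)
  (z : (measurableTypeR R * measurableTypeR R)%type) : measurableTypeR R :=
  (z.1 : R) + (z.2 : R).

Lemma measurable_sum_rv (R : realType) : measurable_fun setT (@sum_rv R).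
Proof.
exact: (measurable_funD measurable_fst measurable_snd).
Qed.

HB.instance Definition _ (R : realType) :=
  @isMeasurableFun.Build _ _ _ _ (@sum_rv R) (@measurable_sum_rv R).

Section Distributions.
Context {R : realType}.
Implicit Types F G : probability (measurableTypeR R) R.

Definition on_nonneg F : Prop := F `[0, +oo[%classic = 1%E.

Definition df F (x : R) : R := fine (cdf (@id_rv R : {RV F >-> R}) x).

Definition tail F (x : R) : R := 1 - df F x.

Definition incr F (a b : R) : R := df F b - df F a.

Definition mean F : \bar R := 'E_F[@id_rv R].

Definition finite_mean F : Prop := (mean F < +oo)%E.

(** The law of the sum of two independent variables with laws [F] and [G]. *)
Definition convolution F G : probability (measurableTypeR R) R :=
  distribution (F \x G)%E (@sum_rv R).

(** Finiteness of the mean is explicit because [fine] sends [+oo] to [0]. *)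
Definition S_star F : Prop :=
  finite_mean F /\
  asymp_eq
    (fun x => \int[lebesgue_measure]_(y in `[0, x])
                (tail F y * tail F (x - y)))
    (fun x => 2 * fine (mean F) * tail F x).

Definition local_long_tailed (t : R) F : Prop :=
  forall e : R, 0 < e -> \forall x \near +oo,
    forall y : R, 0 <= y <= 1 ->
      `|incr F (x + y) (x + y + t) / incr F x (x + t) - 1| < e.

Definition local_subexponential (t : R) F : Prop :=
  local_long_tailed t F /\
  asymp_eq (fun x => incr (convolution F F) x (x + t))
           (fun x => 2 * incr F x (x + t)).

Definition second_order_subexponential F : Prop :=
  [/\ on_nonneg F,
      finite_mean F,
      forall t : R, 0 < t -> local_subexponential t F &
      asymp_eq (fun x => tail (convolution F F) x - 2 * tail F x)
               (fun x => 2 * fine (mean F) * incr F x (x + 1))].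

End Distributions.

(* Main.v *)
From HB Require Import structures.
From mathcomp Require Import ring lra.
Require Import Defs.

(** Write [T] for the tail of [F], [h x] for the mass of ]x, x + 1], [mu] for the
    mean, and let [Y1], [Y2] be independent with law [F].  Splitting the event
    [Y1 + Y2 > x] according to which variables exceed [x / 2]
    ([tail_convolution]) gives, with [I x] the integral over [0, x / 2] of the
    mass of ]x - y, x] with respect to [F (dy)],

      [tail (F * F) x - 2 T x = 2 I x + T (x / 2) ^ 2 - 2 T x T (x / 2)],

    and the last two terms are [o (h x)] by hypothesis.  It remains to see that
    [I x] is equivalent to [mu * h x].

    For bounded [y] local long-tailedness says that near [x] the measure [F] is
    almost [h x] times Lebesgue measure ([incr_uniform_linear]), so that the
    mass of ]x - y, x] is about [y * h x]; integrating over [0, A] with [A]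
    large gives nearly [mu * h x].  The remaining [y] have to be shown
    negligible.  Covering ]x - y, x] by unit cells bounds their contribution by
    the sum over [k <= x / 2] of [T (max A k) * h (x - k - 1)].  The hypothesis
    on the hazard rate [q = h / T] is made for each scale separately, but since
    [q] is insensitive to unit shifts, Baire's theorem makes it uniform over
    compact sets of scales ([ratio_bound_uniform]): [h z <= C * q x * T z] for
    all [z] in [x / 4, x].  Up to a few terms near [x] the sum is then at most
    [C * q x] times a discretization of the integral of [T s * T (x - s)] over
    [A <= s <= x - A].  In S* the two ends of the convolution integral
    exhaust its asymptotic value [2 * mu * T x] as [A] grows, whence the middle
    is a small multiple of [T x] ([S_star_middle]), and [q x * T x = h x]
    ([sum_cells_small]).

    Local subexponentiality follows by subtracting the second order expansions
    at [x] and [x + t], because [h (x + t)] is equivalent to [h x]. *)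

Set Implicit Arguments.
Unset Strict Implicit.
Unset Printing Implicit Defensive.
Local Open Scope classical_set_scope.
Local Open Scope ring_scope.

(** * Distribution functions and bounded shifts *)

Lemma near_pinftyP (R : realType) (P : R -> Prop) :
  (\forall x \near +oo, P x) <-> exists X, forall x, X <= x -> P x.
Proof.
split=> [[X [_ XP]]|[X XP]].
  by exists (X + 1) => x Xx; apply: XP; lra.
by exists X; split; [exact: num_real|move=> x /ltW; exact: XP].
Qed.

Section shifts.
Context {R : realType} (F : probability (measurableTypeR R) R).

Lemma df_nondecreasing : {homo df F : x y / x <= y}.
Proof.
move=> x y xy; rewrite /df fine_le ?fin_num_measure//.
exact: cdf_nondecreasing.
Qed.

Lemma tail_nonincreasing x y : x <= y -> tail F y <= tail F x.
Proof. by move=> xy; rewrite /tail lerB// df_nondecreasing. Qed.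

Lemma tailE x : tail F x = fine (F `]x, +oo[%classic).
Proof.
rewrite /tail /df -[RHS]/(fine (ccdf (@id_rv R : {RV F >-> R}) x)).
by rewrite ccdf_1_cdf fineB ?fin_num_measure.
Qed.

Lemma EFin_tail x : (tail F x)%:E = F `]x, +oo[%classic.
Proof. by rewrite tailE fineK ?fin_num_measure. Qed.

Lemma tail_ge0 x : 0 <= tail F x.
Proof. by rewrite tailE fine_ge0. Qed.

Lemma tail_le1 x : tail F x <= 1.
Proof. by rewrite -lee_fin EFin_tail probability_le1. Qed.

Lemma incr_tail x y : incr F x y = tail F x - tail F y.
Proof. by rewrite /incr /tail; ring. Qed.

Lemma incr_ge0 x y : x <= y -> 0 <= incr F x y.
Proof. by move=> xy; rewrite incr_tail subr_ge0 tail_nonincreasing. Qed.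

Lemma local_long_tailed_gt0 t : 0 <= t -> local_long_tailed t F ->
  \forall x \near +oo, 0 < incr F x (x + t).
Proof.
move=> t0 /(_ 1 ltr01); apply: filterS => x /(_ 0).
rewrite lexx ler01 addr0 => /(_ isT) xt.
rewrite lt_def incr_ge0 ?lerDl// andbT; apply: contraTneq xt => ->.
by rewrite mul0r sub0r normrN1 ltxx.
Qed.

(** Chaining the defining estimate over unit steps extends it to shifts in any
    bounded range; two-sided multiplicative bounds make each step symmetric in
    the two points that it compares. *)
Lemma local_long_tailed_shift t : 0 <= t -> local_long_tailed t F ->
  forall (M : nat) e, 0 < e -> \forall x \near +oo, forall z, 0 <= z <= M%:R ->
    incr F (x - z) (x - z + t) <= (1 + e) * incr F x (x + t) /\
    incr F x (x + t) <= (1 + e) * incr F (x - z) (x - z + t).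
Proof.
move=> t0 FL; set f := fun x => incr F x (x + t).
have f0 x : 0 <= f x by rewrite /f incr_ge0 ?lerDl.
have step e : 0 < e -> exists X, forall x, X <= x -> forall z, 0 <= z <= 1 ->
    f (x + z) <= (1 + e) * f x /\ f x <= (1 + e) * f (x + z).
  move=> e0; have d0 : 0 < e / (1 + e) by rewrite divr_gt0//; lra.
  have dE : (1 + e) * (e / (1 + e)) = e by rewrite mulrC divfK//; lra.
  have : \forall x \near +oo, forall z, 0 <= z <= 1 ->
      f (x + z) <= (1 + e) * f x /\ f x <= (1 + e) * f (x + z).
    near=> x => z z01.
    have fx : 0 < f x by near: x; exact: local_long_tailed_gt0.
    have : `|f (x + z) / f x - 1| < e / (1 + e).
      by move: z z01; near: x; exact: FL.
    have -> : f (x + z) / f x - 1 = (f (x + z) - f x) / f x.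
      by rewrite [RHS]mulrBl divff// gt_eqF.
    rewrite normrM normfV (gtr0_norm fx) ltr_pdivrMr// ltr_norml.
    move: (d0) (dE); set d := e / (1 + e) => d0' dE' /andP[h1 h2].
    have de : d <= e by nra.
    by split; nra.
  by move/near_pinftyP.
elim=> [|M IH] e e0.
  apply/near_pinftyP; exists 0 => x _ z z0.
  have -> : z = 0 by lra.
  by rewrite subr0 -/(f x); have := f0 x; split; nra.
pose d := Num.min 1 e / 3.
have d0 : 0 < d by rewrite divr_gt0// lt_min ltr01.
have d1 : d <= 3^-1 by rewrite /d ler_pdivrMr// mulVf// ge_min lexx.
have de : 3 * d <= e by rewrite /d mulrC divfK// ge_min lexx orbT.
have dd : (1 + d) * (1 + d) <= 1 + e by nra.
have /near_pinftyP[X1 IH1] := IH _ d0; have [X2 IH2] := step _ d0.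
apply/near_pinftyP; exists (Num.max X1 (X2 + M.+1%:R)) => x.
rewrite ge_max => /andP[x1 x2] z /andP[z0 zM].
have := f0 x; have := f0 (x - z); have := f0 (x - M%:R).
have [zM'|zM'] := leP z M%:R.
  have [] := IH1 x x1 z; rewrite ?z0//.
  by rewrite -!/(f _); split; nra.
move: (zM); rewrite -natr1 => zM1.
have [] := IH1 x x1 M%:R; rewrite ?lexx ?ler0n// -!/(f _) => a1 a2.
have [||] := IH2 (x - z) _ (z - M%:R); [lra|lra|].
rewrite (_ : x - z + (z - M%:R) = x - M%:R); last by ring.
by move=> b1 b2; split; nra.
Unshelve. all: by end_near. Qed.

End shifts.

(** * Uniform distribution of mass in bounded windows *)

Section local_uniformity.
Context {R : realType} (F : probability (measurableTypeR R) R).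

(** The mass of [x - 1, x] is comparable with that of each of the next two unit
    intervals, so that it is at most the mass beyond [x]. *)
Lemma tail_shift1 : local_long_tailed 1 F ->
  \forall x \near +oo, tail F (x - 1) <= 2 * tail F x.
Proof.
(* With ratios at most 4/3 the two unit intervals after [x] weigh together at
   least 9/16 + 3/4 > 1 times the one before [x]. *)
move=> FL; have e0 : 0 < 3^-1 :> R by rewrite invr_gt0.
have /near_pinftyP[X XP] := local_long_tailed_shift ler01 FL 2 e0.
apply/near_pinftyP; exists X => x xX.
have x1 : X <= x + 1 by lra.
have [|a1 _] := XP _ x1 2; first by lra.
have [|_ b1] := XP _ x1 1; first by lra.
have E1 : x + 1 - 2 = x - 1 by ring.
have E2 : x + 1 - 1 = x by ring.
have E3 : x - 1 + 1 = x by ring.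
move: a1 b1; rewrite E1 E2 E3 !incr_tail.
have := @tail_nonincreasing _ F (x - 1) x; rewrite gerBl ler01 => /(_ isT).
by have := tail_ge0 F (x + 1 + 1); lra.
Qed.

Lemma incr_le_iter (t c u : R) (k : nat) :
  (forall j, (j < k)%N -> incr F (u + j%:R * t) (u + j%:R * t + t) <= c) ->
  incr F u (u + k%:R * t) <= k%:R * c.
Proof.
elim: k => [|k IH] uk; first by rewrite !mul0r addr0 incr_tail subrr.
have := uk k (ltnSn _).
have /IH : forall j, (j < k)%N -> incr F (u + j%:R * t) (u + j%:R * t + t) <= c.
  by move=> j jk; apply: uk; rewrite ltnS ltnW.
rewrite !incr_tail -natr1 !mulrDl !mul1r addrA.
by lra.
Qed.

Lemma incr_ge_iter (t c u : R) (k : nat) :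
  (forall j, (j < k)%N -> c <= incr F (u + j%:R * t) (u + j%:R * t + t)) ->
  k%:R * c <= incr F u (u + k%:R * t).
Proof.
elim: k => [|k IH] uk; first by rewrite !mul0r addr0 incr_tail subrr.
have := uk k (ltnSn _).
have /IH : forall j, (j < k)%N -> c <= incr F (u + j%:R * t) (u + j%:R * t + t).
  by move=> j jk; apply: uk; rewrite ltnS ltnW.
rewrite !incr_tail -natr1 !mulrDl !mul1r addrA.
by lra.
Qed.

(** The bookkeeping of the cell-counting argument below: [H] stands for the mass
    of a unit interval made of cells of least mass, [h] for the true mass of a
    unit interval, [m] for the mass of an interval of length [y], which contains
    cells of total length [a] and is covered by cells of total length [a + t];
    masses of cells differ by a factor at most [(1 + d) ^+ 2]. *)
Lemma window_estimate (a t d e y A h H m : R) :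
  0 <= a <= y -> y <= a + t -> y <= A -> 0 <= t <= e / 2 -> t <= 1 ->
  0 < d <= 1 -> d * (6 * (A + 1)) <= e -> 0 <= H -> H <= h ->
  h <= (1 + d) ^+ 2 * H -> a * H <= m -> m <= (a + t) * (1 + d) ^+ 2 * H ->
  `|m - y * h| <= e * h.
Proof.
move=> /andP[a0 ay] yat yA /andP[t0 te] t1 /andP[d0 d1] de H0 Hh hH lo up.
have dd : (1 + d) ^+ 2 <= 1 + 3 * d by rewrite expr2; nra.
have h0 : 0 <= h by lra.
have hH' : h <= (1 + 3 * d) * H by apply: (le_trans hH); rewrite ler_wpM2r.
have dH : d * H <= d * h by rewrite ler_wpM2l// ltW.
have dA : d * (a + t) <= d * (A + 1) by rewrite ler_wpM2l ?(ltW d0)//; lra.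
have da : d * a <= d * (A + 1) by rewrite ler_wpM2l ?(ltW d0)//; lra.
have U : m <= (y + e) * h.
  apply: (le_trans up); apply: (@le_trans _ _ ((a + t) * (1 + 3 * d) * h)).
    by apply: ler_pM => //; rewrite ?mulr_ge0 ?sqr_ge0 ?ler_wpM2l//; lra.
  by rewrite ler_wpM2r//; lra.
have L : (y - e) * h <= m.
  apply: le_trans lo; apply: (@le_trans _ _ (a * (h - 3 * d * h))); last first.
    by rewrite ler_wpM2l//; lra.
  rewrite (_ : a * _ = (a - 3 * (d * a)) * h); last by ring.
  by rewrite ler_wpM2r//; lra.
by rewrite ler_norml; apply/andP; split; lra.
Qed.

(** Cutting the line into cells of length [t = 1/N] small, all the cells that
    meet [x - A, x + 1] have about the same mass, so that [F] restricted to
    this window is close to a multiple of Lebesgue measure, the multiple being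
    [incr F x (x + 1)]. *)
Lemma incr_uniform_linear : (forall t : R, 0 < t -> local_long_tailed t F) ->
  forall (A : nat) e, 0 < e -> \forall x \near +oo, forall y, 0 <= y <= A%:R ->
    `|incr F (x - y) x - y * incr F x (x + 1)| <= e * incr F x (x + 1).
Proof.
move=> FL A e e0.
pose n := Num.truncn (2 / e); pose N := n.+1.
have N0 : 0 < N%:R :> R by rewrite ltr0n.
pose t : R := N%:R^-1.
have t0 : 0 < t by rewrite invr_gt0.
have Nt : N%:R * t = 1 by rewrite mulfV// gt_eqF.
have t1 : t <= 1 by rewrite invf_le1// ler1n.
have te : t <= e / 2.
  rewrite -[leRHS]invrK lef_pV2 ?posrE ?invr_gt0 ?divr_gt0// invf_div.
  by rewrite ltW// truncnS_gt.
(* The cells cause two errors, at most [t] from the ends of the interval and at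
   most [3 * d * (A + 1)] from their unequal masses: each is at most [e / 2]. *)
pose d := Num.min 1 e / (6 * A.+1%:R).
have A1 : 1 <= A.+1%:R :> R by rewrite ler1n.
have d0 : 0 < d by rewrite divr_gt0// ?lt_min ?ltr01//; lra.
have dE : d * (6 * A.+1%:R) = Num.min 1 e by rewrite divfK// gt_eqF//; lra.
have d1 : d <= 1.
  rewrite ler_pdivrMr; last by lra.
  by rewrite mul1r (@le_trans _ _ 1) ?ge_min ?lexx//; lra.
have de : d * (6 * A.+1%:R) <= e by rewrite dE ge_min lexx orbT.
have /near_pinftyP[X XP] := local_long_tailed_shift (ltW t0) (FL _ t0) A.+2 d0.
apply/near_pinftyP; exists X => x xX y /andP[y0 yA].
have x1 : X <= x + 1 by lra.
set G := incr F (x + 1) (x + 1 + t).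
have cell u : x - A.+1%:R <= u <= x + 1 ->
    incr F u (u + t) <= (1 + d) * G /\ G <= (1 + d) * incr F u (u + t).
  move=> xu; have [|] := XP _ x1 (x + 1 - u); first by rewrite -natr1; lra.
  by rewrite (_ : x + 1 - (x + 1 - u) = u)//; ring.
have G0 : 0 <= G by rewrite incr_ge0// lerDl ltW.
have G1 c : (1 + d) * c = G -> forall u, x - A.+1%:R <= u <= x + 1 ->
   c <= incr F u (u + t).
  by move=> cG u /cell[_]; rewrite -cG ler_pM2l//; lra.
pose c := G / (1 + d).
have cG : (1 + d) * c = G.
  by rewrite mulrC divfK// gt_eqF//; lra.
have c0 : 0 <= c by rewrite divr_ge0//; lra.
have jt j : (j < N)%N -> j%:R * t <= 1.
  by move=> jN; rewrite -[leRHS]Nt ler_pM2r// ler_nat ltnW.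
have Nx : x + N%:R * t = x + 1 by rewrite Nt.
set h := incr F x (x + 1).
have hle : h <= N%:R * ((1 + d) * G).
  rewrite /h -Nx; apply: incr_le_iter => j jN.
  have := jt _ jN; have : 0 <= j%:R * t by rewrite mulr_ge0// ltW.
  by move=> ? ?; apply: (cell _ _).1; lra.
have hge : N%:R * c <= h.
  rewrite /h -Nx; apply: incr_ge_iter => j jN.
  have := jt _ jN; have : 0 <= j%:R * t by rewrite mulr_ge0// ltW.
  by move=> ? ?; apply: G1 => //; lra.
pose k := Num.truncn (y / t).
have /andP[ky yk] : k%:R * t <= y < k.+1%:R * t.
  by rewrite -ler_pdivlMr// -ltr_pdivrMr// truncn_itv// divr_ge0// ltW.
clearbody G c h k.
have lo : k%:R * c <= incr F (x - y) x.
  apply: (@le_trans _ _ (incr F (x - k%:R * t) x)); last first.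
    by rewrite !incr_tail lerD2r tail_nonincreasing//; lra.
  rewrite -[X in incr F _ X](subrK (k%:R * t)).
  apply: incr_ge_iter => j jk.
  have : j%:R * t <= k%:R * t by rewrite ler_pM2r// ler_nat ltnW.
  have : 0 <= j%:R * t by rewrite mulr_ge0// ltW.
  by move=> ? ?; apply: G1 => //; lra.
have up : incr F (x - y) x <= k.+1%:R * ((1 + d) * G).
  apply: (@le_trans _ _ (incr F (x - k.+1%:R * t) x)).
    by rewrite !incr_tail lerD2r tail_nonincreasing//; lra.
  rewrite -[X in incr F _ X](subrK (k.+1%:R * t)).
  apply: incr_le_iter => j jk.
  have : j%:R * t <= k.+1%:R * t by rewrite ler_pM2r// ler_nat ltnW.
  have : 0 <= j%:R * t by rewrite mulr_ge0// ltW.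
  have : k.+1%:R * t <= A.+1%:R by rewrite -natr1 mulrDl -natr1; lra.
  by move=> ? ? ?; apply: (cell _ _).1; lra.
have kE j : j%:R * c = j%:R * t * (N%:R * c).
  by transitivity (j%:R * c * (N%:R * t)); [rewrite Nt mulr1|ring].
apply: (@window_estimate (k%:R * t) t d e y A%:R h (N%:R * c)).
- by rewrite ky mulr_ge0 ?ler0n// ltW.
- by rewrite ltW// (lt_le_trans yk)// -natr1 mulrDl mul1r.
- exact: yA.
- by rewrite te ltW.
- exact: t1.
- by rewrite d0 d1.
- by rewrite natr1.
- by rewrite mulr_ge0 ?ler0n.
- exact: hge.
- by apply: (le_trans hle); rewrite -cG le_eqVlt; apply/orP; left; apply/eqP; ring.
- by rewrite -kE.
- apply: (le_trans up); rewrite -cG le_eqVlt; apply/orP; left; apply/eqP.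
  transitivity (k.+1%:R * c * (1 + d) ^+ 2); first by ring.
  by rewrite kE -natr1; ring.
Qed.

End local_uniformity.

(** * Uniform bounds for ratios over compact sets of scales *)

Section ratio_bound.
Context {R : realType} (q : R -> R).
Hypothesis q_ge0 : forall x, 0 <= q x.
Variable K : R.
Hypothesis q_shift : \forall x \near +oo, forall y, `|x - y| <= 1 -> q x <= K * q y.
Hypothesis q_ratio : forall y, 0 < y ->
  exists2 M, 0 <= M & \forall x \near +oo, q (x * y) <= M * q x.

Let A (n : nat) := [set u : R | forall x, n%:R <= x -> q (x * expR u) <= n%:R * q x].

(** Each scale satisfies the bound defining [A n] for [n] large, so that the
    closures of the [A n] cover the line and Baire's theorem applies. *)
Lemma ratio_bound_somewhere_dense :
  exists n : nat, ~ dense (~` closure (A n)).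
Proof.
apply: contrapT => /forallNP nA.
have oA n : open (~` closure (A n)) /\ dense (~` closure (A n)).
  by split; [exact/closed_openC/closed_closure|exact: contrapT].
have [u [_ /= Au]] : (setT `&` \bigcap_n ~` closure (A n)) !=set0.
  by apply: (Baire oA); [exists 0|exact: openT].
have [M M0 /near_pinftyP[X XM]] := q_ratio (expR_gt0 u).
pose n := maxn (Num.truncn M).+1 (Num.truncn X).+1.
apply: (Au n I); apply: subset_closure => x nx.
have Mn : M <= n%:R.
  by rewrite (le_trans (ltW (truncnS_gt M)))// ler_nat leq_maxl.
have Xn : X <= n%:R.
  by rewrite (le_trans (ltW (truncnS_gt X)))// ler_nat leq_maxr.
by apply: (le_trans (XM _ (le_trans Xn nx))); rewrite ler_wpM2r.
Qed.

(** The shift estimate on [q] carries the bound from [A n] to its closure, which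
    contains an interval around some [u0]; dilating by [expR (- u0)] moves this
    interval to one around the scale [1 = expR 0]. *)
Lemma ratio_bound_near1 : exists C d, [/\ 0 <= C, 0 < d &
  \forall x \near +oo, forall w, `|w| < d -> q (x * expR w) <= C * q x].
Proof.
have [n nd] := ratio_bound_somewhere_dense.
have [u0 [d d0 dA]] : exists u0, exists2 d, 0 < d & ball u0 d `<=` closure (A n).
  move: nd => /existsNP[U] /not_implyP[[u0 Uu0]] /not_implyP[oU] nU.
  have /nbhs_ballP[d d0 dU] : nbhs u0 U by exact: open_nbhs_nbhs.
  exists u0, d => // v /dU Uv; apply: contrapT => cv; apply: nU.
  by exists v; split.
have /near_pinftyP[X XP] := q_shift.
have [M M0 /near_pinftyP[Y YM]] := q_ratio (expR_gt0 (- u0)).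
have K0 : 0 <= `|K| * n%:R * M by rewrite !mulr_ge0.
exists (`|K| * n%:R * M), d; split => //.
apply/near_pinftyP.
pose c := expR (- u0); have c0 : 0 < c := expR_gt0 _.
exists (Num.max Y (Num.max (n%:R / c) (Num.max 0 (X / expR (- d))))) => x.
rewrite !ge_max ler_pdivrMr// ler_pdivrMr ?expR_gt0// => /and4P[Yx nx x0 Xx] w wd.
have Xw : X <= x * expR w.
  apply: (le_trans Xx); rewrite ler_wpM2l// ler_expR.
  by move: wd; rewrite ltr_norml => /andP[/ltW].
have cA : closure (A n) (u0 + w).
  apply: dA; rewrite -ball_normE /ball_/=.
  by rewrite opprD addrA subrr sub0r normrN.
have xE v : x * expR (v - u0) = (x * c) * expR v.
  by rewrite /c expRD [expR v * _]mulrC mulrA.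
have : \forall v \near u0 + w, `|x * expR (u0 + w - u0) - x * expR (v - u0)| < 1.
  have : x * expR (v - u0) @[v --> u0 + w] --> x * expR (u0 + w - u0).
    apply: cvgM; first exact: cvg_cst.
    apply: (cvg_comp (fun v => v - u0) expR); last exact: continuous_expR.
    by apply: cvgB; [exact: cvg_id|exact: cvg_cst].
  by move=> /cvgrPdist_lt; apply.
move=> /cA[v [Av /ltW xv]].
rewrite (_ : u0 + w - u0 = w) in xv; last by ring.
have := XP _ Xw _ xv; rewrite xE => /le_trans; apply.
have := Av _ nx; have := YM _ Yx; rewrite -/c => h1 h2.
have h3 : q (x * c * expR v) <= n%:R * M * q x.
  by apply: (le_trans h2); rewrite -mulrA ler_wpM2l.
rewrite (@le_trans _ _ (`|K| * q (x * c * expR v)))//.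
  by rewrite ler_wpM2r// ler_norm.
rewrite -(mulrA `|K|) -(mulrA `|K|) ler_wpM2l//.
Qed.

(** Iterating the bound near the scale 1 finitely many times reaches [1/4].
    Uniformity over a compact set of scales is what turns the scale by scale
    hypothesis, where the threshold may depend on the scale, into a bound over
    the whole range [x / 4, x]. *)
Lemma ratio_bound_uniform : exists2 C, 0 <= C &
  \forall x \near +oo, forall z, x / 4 <= z <= x -> q z <= C * q x.
Proof.
have [C1 [d [C10 d0 /near_pinftyP[X1 XP]]]] := ratio_bound_near1.
pose e := d / 2; have e0 : 0 < e by rewrite divr_gt0.
have iter m : exists2 C, 0 <= C & \forall x \near +oo,
    forall w, - (m%:R * e) <= w <= 0 -> q (x * expR w) <= C * q x.
  elim: m => [|m [C C0 /near_pinftyP[X IH]]].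
    exists 1 => //; apply/near_pinftyP; exists 0 => x _ w.
    rewrite mul0r oppr0 -eq_le => /eqP <-.
    by rewrite expR0 mulr1 mul1r.
  exists (C1 * C); first exact: mulr_ge0.
  apply/near_pinftyP; exists (Num.max X (Num.max 0 (X1 / expR (- (m%:R * e))))) => x.
  rewrite !ge_max ler_pdivrMr ?expR_gt0// => /and3P[Xx x0 X1x] w.
  rewrite -natr1 mulrDl mul1r => /andP[wm w0].
  pose v := Num.max w (- (m%:R * e)).
  have vm : - (m%:R * e) <= v by rewrite le_max lexx orbT.
  have m0 : 0 <= m%:R * e by rewrite mulr_ge0 ?ler0n// ltW.
  have v0 : v <= 0 by rewrite ge_max w0 oppr_le0.
  have wv : w <= v by rewrite le_max lexx.
  have vw : v <= w + e by rewrite ge_max; apply/andP; split; lra.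
  rewrite (_ : x * expR w = (x * expR v) * expR (w - v)); last first.
    by rewrite -mulrA -expRD addrC subrK.
  have X1v : X1 <= x * expR v.
    by apply: (le_trans X1x); rewrite ler_wpM2l// ler_expR.
  have ed : e < d by rewrite /e; lra.
  apply: (le_trans (XP _ X1v (w - v) _)).
    by rewrite ler0_norm; lra.
  by rewrite -mulrA ler_wpM2l// IH// vm.
pose m := (Num.truncn (ln 4 / e)).+1.
have [C C0 /near_pinftyP[X XC]] := iter m.
exists C => //; apply/near_pinftyP; exists (Num.max X 1) => x.
rewrite ge_max => /andP[Xx x1] z /andP[z4 zx].
have x0 : 0 < x by lra.
have zx0 : 0 < z / x by rewrite divr_gt0//; lra.
have -> : z = x * expR (ln (z / x)) by rewrite lnK ?posrE// mulrC divfK// gt_eqF.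
apply: XC => //; apply/andP; split; last first.
  by rewrite ln_le0// ler_pdivrMr// mul1r.
apply: (@le_trans _ _ (- ln 4)).
  by rewrite lerN2 -ler_pdivrMr// ltW// truncnS_gt.
rewrite -lnV ?posrE// ler_ln ?posrE ?invr_gt0//.
by rewrite ler_pdivlMr// mulrC.
Qed.

End ratio_bound.

(** * The hazard rate *)

Lemma limf_esup_lty_bounded (R : realType) (f : R -> R) :
  (limf_esup (EFin \o f) (pinfty_nbhs R) < +oo)%E ->
  exists2 M, 0 <= M & \forall x \near +oo, f x <= M.
Proof.
rewrite limf_esupE => /ereal_inf_lt[_ [V V_oo <-] Vlt].
exists `|fine (ereal_sup ((EFin \o f) @` V))| => //.
apply: filterS V_oo => x Vx.
have : ((f x)%:E <= ereal_sup ((EFin \o f) @` V))%E.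
  by apply: ereal_sup_ubound; exists x.
case: (ereal_sup _) Vlt => [r _| // |_ //].
by rewrite lee_fin => /le_trans; apply; exact: ler_norm.
Qed.

Section hazard.
Context {R : realType} (F : probability (measurableTypeR R) R).
Let h x := incr F x (x + 1).

Lemma incr1_ge0 x : 0 <= incr F x (x + 1).
Proof. by rewrite incr_ge0 ?lerDl. Qed.

Lemma incr_le_tail x y : incr F x y <= tail F x.
Proof. by rewrite incr_tail gerBl tail_ge0. Qed.

(** Far out, a unit shift changes both the mass of a unit interval and the tail
    by at most a factor 2. *)
Lemma hazard_shift1 : local_long_tailed 1 F ->
  \forall x \near +oo, forall y, `|x - y| <= 1 ->
    h x / tail F x <= 4 * (h y / tail F y).
Proof.
move=> FL; have /near_pinftyP[X XP] := local_long_tailed_shift ler01 FL 1 ltr01.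
have /near_pinftyP[Y YP] := tail_shift1 FL.
have /near_pinftyP[Z ZP] := local_long_tailed_gt0 ler01 FL.
apply/near_pinftyP; exists (Num.max X (Num.max Y (Z + 1))) => x.
rewrite !ge_max => /and3P[xX xY xZ] y; rewrite ler_norml => /andP[xy1 xy2].
have Tx : 0 < tail F x by rewrite (lt_le_trans _ (incr_le_tail x (x + 1)))// ZP//; lra.
have Ty : 0 < tail F y by rewrite (lt_le_trans _ (incr_le_tail y (y + 1)))// ZP//; lra.
have TT : tail F y <= 2 * tail F x.
  by apply: le_trans (YP _ xY); apply: tail_nonincreasing; lra.
have hh : h x <= 2 * h y.
  have [yx|xy] := leP y x.
    have [|_] := XP _ xX (x - y); first by lra.
    by have -> : x - (x - y) = y by ring.
  have Xy : X <= y by lra.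
  have [|+ _] := XP _ Xy (y - x); first by lra.
  by have -> : y - (y - x) = x by ring.
rewrite ler_pdivrMr// mulrAC mulrA ler_pdivlMr//.
have := incr1_ge0 x; have := incr1_ge0 y; rewrite -!/(h _) => hy hx.
by apply: (@le_trans _ _ (2 * h y * (2 * tail F x))); [apply: ler_pM => //; exact: ltW|nra].
Qed.

(** This bound replaces masses of unit intervals by tails, at the price of the
    factor [h x / tail F x]; sums of masses over cells are thereby reduced to
    the convolution integral of the tail. *)
Lemma incr1_hazard_bound : local_long_tailed 1 F ->
  (forall y : R, 0 < y -> (limf_esup
    (fun x : R => (h (x * y) / tail F (x * y) / (h x / tail F x))%:E)
    (pinfty_nbhs R) < +oo)%E) ->
  exists2 C, 0 <= C & \forall x \near +oo, forall z, x / 4 <= z <= x ->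
    h z <= C * (h x / tail F x) * tail F z.
Proof.
move=> FL qL; have /near_pinftyP[Z ZP] := local_long_tailed_gt0 ler01 FL.
have T0 x : Z <= x -> 0 < tail F x.
  by move=> Zx; rewrite (lt_le_trans _ (incr_le_tail x (x + 1)))// ZP.
pose q x := h x / tail F x.
have [|y y0|C C0 /near_pinftyP[X XP]] := @ratio_bound_uniform _ q _ 4 (hazard_shift1 FL).
- by move=> x; rewrite divr_ge0 ?incr1_ge0 ?tail_ge0.
- have [M M0 /near_pinftyP[Y YP]] := limf_esup_lty_bounded (qL _ y0).
  exists M => //; apply/near_pinftyP; exists (Num.max Y Z) => x.
  rewrite ge_max => /andP[Yx Zx]; rewrite -ler_pdivrMr; first exact: YP.
  by rewrite divr_gt0// ?T0// ZP.
exists C => //; apply/near_pinftyP; exists (Num.max X (Num.max 0 (4 * Z))) => x.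
rewrite !ge_max => /and3P[Xx x0 Zx] z zx.
by rewrite -ler_pdivrMr; [exact: XP|apply: T0; lra].
Qed.

(** Counting unit cells from the right end, ]x - y, x] meets only those of index
    [k < y]. *)
Lemma incr_le_sum_cells x y (N : nat) : 0 <= y <= N%:R ->
  incr F (x - y) x <= \sum_(k < N) (k%:R < y)%R%:R * h (x - k.+1%:R).
Proof.
elim: N y => [|N IH] y /andP[y0 yN].
  by rewrite big_ord0 incr_tail subr_le0 tail_nonincreasing//; lra.
rewrite big_ord_recr/=; have [yN'|yN'] := leP y N%:R.
  by rewrite mul0r addr0 IH// y0.
have := IH N%:R; rewrite ler0n lexx mul1r => /(_ isT).
have -> : \sum_(k < N) (k%:R < N%:R :> R)%R%:R * h (x - k.+1%:R) =
          \sum_(k < N) (k%:R < y)%R%:R * h (x - k.+1%:R).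
  apply: eq_bigr => k _; rewrite ltr_nat ltn_ord (lt_trans _ yN')//.
  by rewrite ltr_nat.
rewrite {3}/h !incr_tail.
have -> : x - N.+1%:R + 1 = x - N%:R by rewrite -natr1; ring.
have := @tail_nonincreasing _ F (x - N.+1%:R) (x - y).
by rewrite lerD2l lerN2 => /(_ yN); lra.
Qed.

End hazard.

(** * Integrals over intervals and reflection of Lebesgue measure *)

Definition reflection (R : realType) (c : R) (s : measurableTypeR R) :
  measurableTypeR R := c - s.

Lemma measurable_reflection (R : realType) (c : R) :
  measurable_fun setT (reflection c).
Proof.
by apply: measurable_funB; [exact: measurable_cst|exact: measurable_id].
Qed.

HB.instance Definition _ (R : realType) (c : R) :=
  @isMeasurableFun.Build _ _ _ _ (reflection c) (measurable_reflection c).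

Section integrals.
Context {R : realType}.

Lemma ge0_integral_itv_split (m : {measure set (measurableTypeR R) -> \bar R})
    (a c : itv_bound R) (b : itv_bound R) (f : measurableTypeR R -> \bar R) :
  (a <= b)%O -> (b <= c)%O -> measurable_fun setT f ->
  (forall x, x \in Interval a c -> (0 <= f x)%E) ->
  (\int[m]_(x in [set` Interval a c]) f x =
   \int[m]_(x in [set` Interval a b]) f x +
   \int[m]_(x in [set` Interval b c]) f x)%E.
Proof.
move=> ab bc mf f0; rewrite (itv_bndbnd_setU ab bc) ge0_integral_setU//.
- exact: measurable_funTS.
- by move=> x; rewrite -itv_bndbnd_setU// => /f0.
- apply/disj_setPS => y [/=]; rewrite !itv_boundlr => /andP[_ yb] /andP[by' _].
  by have := le_trans yb by'; rewrite bnd_simp ltxx.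
Qed.

Lemma ge0_integral_cut (m : {measure set (measurableTypeR R) -> \bar R})
    (f : measurableTypeR R -> \bar R) (v e : R) :
  measurable_fun setT f -> (forall x, 0 <= x -> (0 <= f x)%E) ->
  (\int[m]_(x in `[0%R, +oo[) f x = v%:E)%E -> 0 < e ->
  exists A : nat, forall B : R, A%:R <= B ->
    ((v - e)%:E <= \int[m]_(x in `[0%R, B]) f x)%E.
Proof.
move=> mf f0 fv e0.
pose D (n : nat) : set (measurableTypeR R) := `[0%R, n%:R]%classic.
have mD n : measurable (D n) by exact: measurable_itv.
have mfD n : measurable_fun (D n) f by exact: measurable_funTS.
have : (\int[m]_(x in D n) f x @[n --> \oo] --> \int[m]_(x in \bigcup_n D n) f x)%E.
  apply: ge0_nondecreasing_set_cvg_integral => //.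
  - apply/nondecreasing_seqP => n; rewrite subsetEset /D => x/=.
    by rewrite !in_itv/= => /andP[-> xn]; rewrite (le_trans xn)// ler_nat.
  - by move=> n x; rewrite /D/= in_itv/= => /andP[/f0].
rewrite (_ : \bigcup_n D n = `[0%R, +oo[%classic); last first.
  apply/seteqP; split => x/=.
    by move=> [n _]; rewrite /D/= !in_itv/= => /andP[->].
  rewrite in_itv/= andbT => x0; exists (Num.truncn x).+1 => //.
  by rewrite /D/= in_itv/= x0 ltW// truncnS_gt.
have vN : nbhs v%:E [set y | (v - e)%:E < y]%E.
  apply: open_nbhs_nbhs; split; first exact: open_ereal_gt_ereal.
  by rewrite /= lte_fin ltrBlDr ltrDl.
rewrite fv => /(_ _ vN)[A _ AP].
exists A => B AB; have := ltW (AP A (leqnn _)); move=> /le_trans; apply.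
apply: ge0_subset_integral => //.
- exact: measurable_funTS.
- by move=> x/=; rewrite in_itv/= => /andP[/f0].
- by move=> x; rewrite /D/= !in_itv/= => /andP[-> xA]; rewrite (le_trans xA).
Qed.

Lemma reflection_itv (c a b : R) :
  reflection c @^-1` `[a, b]%classic = `[c - b, c - a]%classic.
Proof.
apply/seteqP; split => x /=; rewrite /reflection !in_itv/= => /andP[? ?];
  by apply/andP; split; lra.
Qed.

Lemma lebesgue_measure_reflection (c : R) (A : set (measurableTypeR R)) :
  measurable A ->
  pushforward (@lebesgue_measure R) (reflection c) A = lebesgue_measure A.
Proof.
move=> mA; apply/esym.
apply: lebesgue_measure_unique => //= _ [[a b]] _ <-.
rewrite /pushforward.
have -> : reflection c @^-1` `]a, b]%classic = `[c - b, c - a[%classic.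
  apply/seteqP; split => x /=; rewrite /reflection !in_itv/= => /andP[? ?];
  by apply/andP; split; lra.
rewrite !lebesgue_measure_itv/= !lte_fin ltrD2l ltrN2.
by rewrite -!EFinB; case: ifPn => // _; congr EFin; ring.
Qed.

Lemma ge0_integral_reflection (c a b : R) (f : R -> \bar R) :
  measurable_fun setT f -> (forall x, (0 <= f x)%E) ->
  (\int[lebesgue_measure]_(s in `[(c - b)%R, (c - a)%R]) f (c - s)%R =
   \int[lebesgue_measure]_(s in `[a, b]) f s)%E.
Proof.
move=> mf f0.
rewrite [RHS](eq_measure_integral (pushforward lebesgue_measure (reflection c)));
  last by move=> A mA _; rewrite -[LHS](lebesgue_measure_reflection c).
rewrite ge0_integral_pushforward//; last exact: measurable_funTS.
by rewrite reflection_itv.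
Qed.

End integrals.

(** * The mean and the class S* *)

Section mean_and_S_star.
Context {R : realType} (F : probability (measurableTypeR R) R).
Hypothesis F0 : on_nonneg F.
Hypothesis Fm : finite_mean F.
Let mu := fine (mean F).

Lemma measurable_tail : measurable_fun setT (tail F).
Proof.
by apply: nonincreasing_measurable => // x y; exact: tail_nonincreasing.
Qed.

Lemma measurable_EFin_tail (D : set (measurableTypeR R)) :
  measurable_fun D (fun s : measurableTypeR R => (tail F s)%:E).
Proof. by apply: measurable_funTS; apply/measurable_EFinP; exact: measurable_tail. Qed.

Lemma measure_neg : F `]-oo, 0[%classic = 0%E.
Proof.
have := probability_setC F (@measurable_itv R `[0, +oo[).
by rewrite setCitvr F0 subee.
Qed.

(** The formula for the mean as an integral of the tail asks for a random
    variable that is nonnegative everywhere, whereas the identity is so only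
    almost everywhere. *)
Lemma mean_pos_part : mean F = (\int[F]_x ((@id_rv R)^\+%R x)%:E)%E.
Proof.
rewrite /mean expectation_def; apply: ae_eq_integral => //.
- exact/measurable_EFinP/measurable_id.
- by apply/measurable_EFinP; apply: measurable_funrpos; exact: measurable_id.
exists `]-oo, 0[%classic; split; [exact: measurable_itv|exact: measure_neg|].
move=> x /= /not_implyP[_ xx]; rewrite in_itv/= ltNge; apply/negP => x0.
by apply: xx; rewrite /funrpos/= /id_rv max_l.
Qed.

Lemma mean_integral : mean F = (\int[F]_(y in `[0%R, +oo[) y%:E)%E.
Proof.
rewrite mean_pos_part [RHS]integral_mkcond; apply: eq_integral => x _.
rewrite patchE /funrpos/= /id_rv; case: ifPn => [|].
  by rewrite inE/= in_itv/= andbT => x0; rewrite max_l.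
rewrite notin_setE/= in_itv/= andbT => /negP; rewrite -ltNge => x0.
by rewrite max_r// ltW.
Qed.

Lemma mean_ge0 : (0 <= mean F)%E.
Proof.
by rewrite mean_integral integral_ge0// => x; rewrite /= in_itv/= andbT lee_fin.
Qed.

Lemma EFin_mean : mu%:E = mean F.
Proof. by rewrite fineK// ge0_fin_numE// mean_ge0. Qed.

Lemma mean_integral_tail :
  mean F = (\int[lebesgue_measure]_(s in `[0%R, +oo[) (tail F s)%:E)%E.
Proof.
have E : mean F = ('E_F[((@id_rv R)^\+)%R : {RV F >-> R}])%E.
  by rewrite mean_pos_part expectation_def.
rewrite E ge0_expectation_ccdf; last by move=> x; exact: funrpos_ge0.
apply: eq_integral => r; rewrite inE/= in_itv/= andbT => r0.
rewrite EFin_tail /ccdf /distribution /pushforward; congr (F _).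
apply/seteqP; split => x/=; rewrite !in_itv/= !andbT /funrpos/= /id_rv lt_max.
  by rewrite [r < 0]ltNge r0 orbF.
by move=> ->.
Qed.

Lemma mean_cut e : 0 < e -> exists A : nat, forall B : R, A%:R <= B ->
  ((mu - e)%:E <= \int[F]_(y in `[0%R, B]) y%:E)%E.
Proof.
move=> e0; apply: ge0_integral_cut e0 => //.
by rewrite -mean_integral EFin_mean.
Qed.

Lemma tail_integral_cut e : 0 < e -> exists A : nat, forall B : R, A%:R <= B ->
  ((mu - e)%:E <= \int[lebesgue_measure]_(s in `[0%R, B]) (tail F s)%:E)%E.
Proof.
move=> e0; apply: ge0_integral_cut e0 => //.
- exact: measurable_EFin_tail.
- by move=> x _; rewrite lee_fin tail_ge0.
- by rewrite -mean_integral_tail EFin_mean.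
Qed.

(** Markov's inequality for the part of the mean beyond [B]. *)
Lemma integral_id_itv_le B : 0 <= B ->
  (\int[F]_(y in `[0%R, B]) y%:E + (B * tail F B)%:E <= mu%:E)%E.
Proof.
move=> B0; rewrite EFin_mean mean_integral.
rewrite (@itv_bndbnd_setU _ _ (BLeft 0) (BRight B) (BInfty _ false)) ?bnd_simp//.
rewrite ge0_integral_setU//=.
- rewrite leeD2l// EFinM EFin_tail -integral_cst//.
  apply: ge0_le_integral => //.
  by move=> x/=; rewrite in_itv/= andbT lee_fin => /ltW.
- move=> x [|]/=; rewrite in_itv/= lee_fin; first by case/andP.
  by rewrite andbT => /ltW; exact: le_trans.
- apply/disj_setPS => y [/=]; rewrite !in_itv/= => /andP[_ yB].
  by rewrite andbT ltNge yB.
Qed.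

Lemma tail_mul_small e : 0 < e -> exists A : nat, forall B : R, A%:R <= B ->
  B * tail F B <= e.
Proof.
move=> e0; have [A AP] := mean_cut e0; exists A => B AB.
have B0 : 0 <= B by rewrite (le_trans _ AB).
have := le_trans (leeD2r _ (AP _ AB)) (integral_id_itv_le B0).
by rewrite -EFinD lee_fin; lra.
Qed.

Lemma integral_id_le B : (\int[F]_(y in `[0%R, B]) y%:E <= mu%:E)%E.
Proof.
rewrite EFin_mean mean_integral; apply: ge0_subset_integral => //.
- by move=> x/=; rewrite in_itv/= andbT lee_fin.
- by move=> x/=; rewrite !in_itv/= andbT => /andP[].
Qed.

Let G (X : R) (s : measurableTypeR R) := (tail F s * tail F (X - s))%:E.

Let G_ge0 X s : (0 <= G X s)%E.
Proof. by rewrite lee_fin mulr_ge0 ?tail_ge0. Qed.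

Lemma measurable_tail_mul_tail X D : measurable_fun D (G X).
Proof.
apply: measurable_funTS.
apply/measurable_EFinP; apply: measurable_funM; first exact: measurable_tail.
apply: (measurableT_comp measurable_tail).
by apply: measurable_funB; [exact: measurable_cst|exact: measurable_id].
Qed.

Let measurable_G := measurable_tail_mul_tail.

Lemma S_star_upper : S_star F -> forall e, 0 < e -> \forall X \near +oo,
  (\int[lebesgue_measure]_(s in `[0%R, X]) G X s
   <= ((2 * mu + e) * tail F X)%:E)%E.
Proof.
move=> [_ FS] e e0.
(* The asymptotic equivalence excludes a vanishing mean, since a quotient by 0
   is 0. *)
have [mu0|mu0] := eqVneq mu 0.
  have : (0 : R) = 1; last by move/eqP; rewrite eq_sym oner_eq0.
  move: FS; rewrite /asymp_eq -/mu mu0.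
  under eq_fun do rewrite mulr0 mul0r invr0 mulr0.
  exact: cvg_unique (cvg_cst 0).
have mup : 0 < mu by rewrite lt_def mu0 fine_ge0// mean_ge0.
have d0 : 0 < e / (2 * mu) by rewrite divr_gt0// mulr_gt0.
have nearS : \forall X \near +oo,
    `|1 - (\int[lebesgue_measure]_(y in `[0, X]) (tail F y * tail F (X - y)))
      / (2 * mu * tail F X)| < Num.min 1 (e / (2 * mu)).
  by move: FS; rewrite /asymp_eq -/mu => /cvgrPdist_lt; apply; rewrite lt_min ltr01.
apply: filterS nearS => X; rewrite lt_min.
set J := (X in X / _); have [->|T0] := eqVneq (tail F X) 0.
  by rewrite mulr0 invr0 mulr0 subr0 normr1 ltxx.
have Tp : 0 < 2 * mu * tail F X by rewrite !mulr_gt0// lt_def T0 tail_ge0.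
have Jfin : (\int[lebesgue_measure]_(s in `[0%R, X]) G X s \is a fin_num)%E.
  rewrite ge0_fin_numE ?integral_ge0//.
  apply: (@le_lt_trans _ _ (\int[lebesgue_measure]_(s in `[0%R, X]) 1%:E)%E).
    apply: ge0_le_integral => //.
    move=> s _; rewrite lee_fin -[leRHS]mulr1.
    by apply: ler_pM; rewrite ?tail_ge0 ?tail_le1.
  rewrite integral_cst// mul1e [ltLHS](lebesgue_measure_itv `[0%R, X])/= lte_fin.
  by case: ifP => _; rewrite ?ltry.
have JE : (\int[lebesgue_measure]_(s in `[0%R, X]) G X s = J%:E)%E.
  by rewrite /J /Rintegral fineK.
rewrite JE lee_fin => /andP[_]; rewrite ltr_norml => /andP[+ _].
rewrite ltrBrDr addrC ltrBlDr ltr_pdivrMr// => /ltW /le_trans; apply.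
rewrite le_eqVlt; apply/orP; left; apply/eqP.
by rewrite mulrDl mul1r mulrA divfK ?mulf_neq0// -mulrDl.
Qed.

(** By symmetry each end of the convolution integral contributes at least
    [tail F X] times the integral of the tail over [0, A], which is nearly
    [mu * tail F X].  The two ends thus account for nearly the whole integral,
    so that its middle part is negligible. *)
Lemma S_star_middle : S_star F -> forall e, 0 < e ->
  exists A0 : nat, forall A : R, A0%:R <= A -> \forall X \near +oo,
  (\int[lebesgue_measure]_(s in `]A, (X - A)%R[) G X s <= (e * tail F X)%:E)%E.
Proof.
move=> FS e e0; have e3 : 0 < e / 3 by rewrite divr_gt0.
have [A0 AP] := tail_integral_cut e3; exists A0 => A /[dup] A0A /AP cutA.
have Ap : 0 <= A by rewrite (le_trans _ A0A).
near=> X.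
have XA : 2 * A < X by near: X; exact: (nbhs_pinfty_gt (num_real _)).
have T0 := tail_ge0 F X.
have : (\int[lebesgue_measure]_(s in `[0%R, X]) G X s
   <= ((2 * mu + e / 3) * tail F X)%:E)%E by near: X; exact: S_star_upper.
have left : (((mu - e / 3) * tail F X)%:E <=
    \int[lebesgue_measure]_(s in `[0%R, A]) G X s)%E.
  rewrite mulrC EFinM (le_trans (lee_wpmul2l _ cutA))// -ge0_integralZl//.
  - apply: ge0_le_integral => //.
    + by move=> s _; rewrite mule_ge0 ?lee_fin ?tail_ge0.
    + by apply: measurable_funeM; exact: measurable_EFin_tail.
    + move=> s /=; rewrite in_itv/= => /andP[s0 _].
      rewrite -EFinM lee_fin mulrC ler_wpM2l ?tail_ge0//.
      by apply: tail_nonincreasing; lra.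
  - exact: measurable_EFin_tail.
  - by move=> s _; rewrite lee_fin tail_ge0.
have right : (\int[lebesgue_measure]_(s in `[(X - A)%R, X]) G X s =
    \int[lebesgue_measure]_(s in `[0%R, A]) G X s)%E.
  rewrite -(ge0_integral_reflection X 0 A (@measurable_G X _) (G_ge0 X)) subr0.
  by apply: eq_integral => s _; rewrite /G mulrC subKr.
have s1 : (BLeft 0 <= BRight A)%O by rewrite bnd_simp.
have s2 : (BRight A <= BRight X)%O by rewrite bnd_simp; lra.
have s3 : (BRight A <= BLeft (X - A))%O by rewrite bnd_simp; lra.
have s4 : (BLeft (X - A) <= BRight X)%O by rewrite bnd_simp; lra.
rewrite (ge0_integral_itv_split _ s1 s2 (@measurable_G X _) (fun s _ => G_ge0 X s)).
rewrite (ge0_integral_itv_split _ s3 s4 (@measurable_G X _) (fun s _ => G_ge0 X s)).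
rewrite right; move: left.
pose a := (\int[lebesgue_measure]_(s in `[0%R, A]) G X s)%E.
pose b := (\int[lebesgue_measure]_(s in `]A, (X - A)%R[) G X s)%E.
rewrite -/a -/b => la lab.
have /fineK : a \is a fin_num.
  rewrite ge0_fin_numE ?integral_ge0//; apply: le_lt_trans (ltry _).
  by apply: le_trans lab; rewrite leeDl// adde_ge0// integral_ge0.
have /fineK : b \is a fin_num.
  rewrite ge0_fin_numE ?integral_ge0//; apply: le_lt_trans (ltry _).
  by apply: le_trans lab; rewrite addeCA leeDl// adde_ge0// integral_ge0.
by move=> Eb Ea; move: la lab; rewrite -Eb -Ea -!EFinD !lee_fin; lra.
Unshelve. all: by end_near. Qed.

(** For [s] in ]k - 1, k] both [tail F k <= tail F s] and
    [tail F (X - k + 1) <= tail F (X - s)]; comparing the sum with the integral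
    hence costs a shift by 2 between [X] and the total [X + 2] of the sum. *)
Lemma sum_tail_tail_le_integral (A N : nat) X : (A <= N)%N ->
  ((\sum_(A.+1 <= k < N.+1) tail F k%:R * tail F (X + 2 - k.+1%:R))%:E <=
   \int[lebesgue_measure]_(s in `]A%:R, N%:R]) G X s)%E.
Proof.
elim: N => [|N IH]; first by rewrite leqn0 => /eqP ->; rewrite big_geq ?integral_ge0.
rewrite leq_eqVlt => /predU1P[->|]; first by rewrite big_geq ?integral_ge0.
rewrite ltnS => AN; rewrite big_nat_recr//=.
rewrite (@ge0_integral_itv_split _ _ _ _ (BRight N%:R)) ?bnd_simp ?ler_nat//.
rewrite EFinD leeD ?IH//.
apply: (@le_trans _ _ (\int[lebesgue_measure]_(s in `]N%:R, N.+1%:R])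
  (tail F N.+1%:R * tail F (X + 2 - N.+2%:R))%:E)%E).
  rewrite integral_cst// [X in (_ <= _ * X)%E](_ : _ = 1%E) ?mule1//.
  rewrite [LHS](lebesgue_measure_itv `]N%:R, N.+1%:R])/= lte_fin ltr_nat ltnSn.
  by rewrite -EFinB -natr1 [_ + 1 - _]addrAC subrr add0r.
apply: ge0_le_integral => //.
- by move=> s _; rewrite lee_fin mulr_ge0 ?tail_ge0.
- move=> s /=; rewrite in_itv/= => /andP[Ns sN].
  rewrite lee_fin ler_pM ?tail_ge0// tail_nonincreasing//.
  have -> : N.+2%:R = N%:R + 2 :> R by rewrite -addn2 natrD.
  by lra.
Qed.

End mean_and_S_star.

(** * Splitting the convolution *)

Section convolution_split.
Context {R : realType} (F : probability (measurableTypeR R) R).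
Hypothesis F0 : on_nonneg F.

Lemma measurable_tail_comp_sub (x : R) (D : set (measurableTypeR R)) :
  measurable_fun D (fun y : measurableTypeR R => (tail F (x - y))%:E).
Proof.
apply: measurable_funTS; apply/measurable_EFinP.
exact: (measurableT_comp (measurable_tail F) (measurable_reflection x)).
Qed.

Lemma measurable_incr_sub (x : R) (D : set (measurableTypeR R)) :
  measurable_fun D (fun y : measurableTypeR R => (incr F (x - y) x)%:E).
Proof.
have -> : (fun y : measurableTypeR R => (incr F (x - y) x)%:E) =
          (fun y : measurableTypeR R => (tail F (x - y))%:E - (tail F x)%:E)%E.
  by apply/funext => y; rewrite incr_tail EFinB.
by apply: emeasurable_funB => //; exact: measurable_tail_comp_sub.
Qed.

Lemma measure_itv0 b : 0 <= b -> F `[0, b]%classic = (1 - tail F b)%:E.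
Proof.
move=> b0; pose L : set (measurableTypeR R) := `[0, b]%classic.
pose U : set (measurableTypeR R) := `]b, +oo[%classic.
have mL : measurable L by exact: measurable_itv.
have mU : measurable U by exact: measurable_itv.
have LU : L `&` U = set0.
  apply/seteqP; split => y //= []; rewrite /L /U/= !in_itv/= => /andP[_ yb].
  by rewrite andbT ltNge yb.
have : F (L `|` U) = 1%E by rewrite /L /U -itv_bndbnd_setU ?bnd_simp.
rewrite measureU// => FLU.
rewrite EFinB EFin_tail -/L -/U (_ : 1%:E = F L + F U)%E//.
by rewrite addeK ?fin_num_measure.
Qed.

Let lower (x : R) : set (measurableTypeR R) := [set y : R | y <= x / 2].

Let measurable_lower x : measurable (lower x).
Proof.
suff -> : lower x = `]-oo, x / 2]%classic by exact: measurable_itv.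
by apply/seteqP; split => y /=; rewrite in_itv.
Qed.

Let B (x : R) : set (measurableTypeR R * measurableTypeR R) :=
  @sum_rv R @^-1` `]x, +oo[%classic.

Let measurable_B x : measurable (B x).
Proof. by rewrite -[X in measurable X]setTI; exact: measurable_sum_rv. Qed.

Lemma integral_tail_lower x :
  0 <= x ->
  (\int[F]_y (if (y <= x / 2)%R then (tail F (x - y))%:E else 0) =
   \int[F]_(y in `[0%R, (x / 2)%R]) (incr F (x - y) x)%:E
   + (tail F x * (1 - tail F (x / 2)))%:E)%E.
Proof.
move=> x0; have x20 : 0 <= x / 2 by rewrite divr_ge0.
transitivity (\int[F]_(y in `]-oo, (x / 2)%R]) (tail F (x - y))%:E)%E.
  rewrite [RHS]integral_mkcond; apply: eq_integral => y _.
  rewrite patchE; case: ifPn => yx.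
    by rewrite ifT// inE/= in_itv.
  by rewrite ifF//; apply/negbTE; rewrite notin_setE/= in_itv/=; exact/negP.
have T0 y : (0 <= (tail F (x - y))%:E)%E by rewrite lee_fin tail_ge0.
rewrite (@ge0_integral_itv_split _ _ _ _ (BLeft 0)) ?bnd_simp//; last first.
  exact: measurable_tail_comp_sub.
rewrite [X in (X + _)%E](_ : _ = 0%E) ?add0e; last first.
  apply: null_set_integral => //; first exact: measurable_tail_comp_sub.
  exact: measure_neg.
rewrite EFinM -measure_itv0// -integral_cst// -ge0_integralD//.
- by apply: eq_integral => y _; rewrite incr_tail/= -EFinD subrK.
- move=> y/=; rewrite in_itv/= => /andP[y0 _].
  by rewrite lee_fin incr_ge0//; lra.
- exact: measurable_incr_sub.
- by move=> y _; rewrite lee_fin tail_ge0.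
Qed.

Lemma measure_sum_left x :
  (F \x F)%E (B x `&` (lower x `*` setT)) =
  (\int[F]_y (if (y <= x / 2)%R then (tail F (x - y))%:E else 0))%E.
Proof.
apply: eq_integral => y _ /=; case: ifPn => yx.
  rewrite EFin_tail; congr (F _); apply/seteqP; split => z /=.
    rewrite /xsection/= inE => -[+ _]; rewrite /B/= !in_itv/= !andbT /sum_rv/=.
    by lra.
  rewrite in_itv/= andbT => yz; rewrite /xsection/= inE; split => //.
  by rewrite /B/= in_itv/= andbT /sum_rv/=; lra.
rewrite (_ : xsection _ _ = set0) ?measure0//; apply/seteqP; split => z //=.
by rewrite /xsection/= inE => -[_ [+ _]]; rewrite /lower/= (negbTE yx).
Qed.

Lemma measure_sum_right x :
  (F \x F)%E (B x `&` (setT `*` lower x)) =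
  (\int[F]_y (if (y <= x / 2)%R then (tail F (x - y))%:E else 0))%E.
Proof.
have mD : measurable (B x `&` (setT `*` lower x)).
  apply: measurableI => //; apply: measurableX => //.
rewrite (@product_measure_unique _ _ _ _ _ F F (F \x^ F)%E)//; last first.
  by move=> C D mC mD'; exact: product_measure2E.
apply: eq_integral => y _ /=; case: ifPn => yx.
  rewrite EFin_tail; congr (F _); apply/seteqP; split => z /=.
    rewrite /ysection/= inE => -[+ _]; rewrite /B/= !in_itv/= !andbT /sum_rv/=.
    by lra.
  rewrite in_itv/= andbT => yz; rewrite /ysection/= inE; split => //.
  by rewrite /B/= in_itv/= andbT /sum_rv/=; lra.
rewrite (_ : ysection _ _ = set0) ?measure0//; apply/seteqP; split => z //=.
by rewrite /ysection/= inE => -[_ [_ +]]; rewrite /lower/= (negbTE yx).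
Qed.

(** The sum of two independent variables exceeds [x] when one of them, at most
    [x / 2], is compensated by the other one, or when both exceed [x / 2].  The
    first event comes in two versions of equal probability; conditioning on the
    smaller variable [y], the other one has to exceed [x - y], which is [x] up
    to the increment over [x - y, x]. *)
Lemma tail_convolution x : 0 <= x ->
  (\int[F]_(y in `[0%R, (x / 2)%R]) (incr F (x - y) x)%:E)%E =
  ((tail (convolution F F) x - 2 * tail F x - tail F (x / 2) ^+ 2
    + 2 * tail F x * tail F (x / 2)) / 2)%:E.
Proof.
move=> x0.
pose m : {measure set (measurableTypeR R * measurableTypeR R) -> \bar R} := (F \x F)%E.
pose B1 := B x `&` (lower x `*` setT).
pose B2 := B x `&` (setT `*` lower x).
pose B3 : set (measurableTypeR R * measurableTypeR R) :=
  (`]x / 2, +oo[%classic `*` `]x / 2, +oo[%classic).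
have mB1 : measurable B1 by apply: measurableI => //; exact: measurableX.
have mB2 : measurable B2 by apply: measurableI => //; exact: measurableX.
have mB3 : measurable B3 by exact: measurableX.
have BE : B x = B1 `|` B2 `|` B3.
  apply/seteqP; split => -[y z]; rewrite /B1 /B2 /B3/= /lower/= !in_itv/= !andbT.
    move=> Bx; have [yx|yx] := leP y (x / 2); first by left; left.
    by have [zx|zx] := leP z (x / 2); [left; right|right].
  move=> [[[]//|[]//]|[yx zx]].
  by rewrite /B/= in_itv/= andbT /sum_rv/=; lra.
have d12 : B1 `&` B2 = set0.
  apply/seteqP; split => -[y z] //=.
  rewrite /B1 /B2 /B/= in_itv/= andbT /sum_rv/= /lower/=.
  by move=> [[yz [yx _]] [_ [_ zx]]]; lra.
have d123 : (B1 `|` B2) `&` B3 = set0.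
  apply/seteqP; split => -[y z] //=.
  rewrite /B1 /B2 /B3/= /lower/= !in_itv/= !andbT.
  by move=> [[[_ [yx _]]|[_ [_ zx]]] [yx' zx']]; lra.
have cE : (tail (convolution F F) x)%:E = m (B x) by rewrite EFin_tail.
have m12 : m (B1 `|` B2) = (m B1 + m B2)%E by exact: measureU.
have m123 : m (B1 `|` B2 `|` B3) = (m (B1 `|` B2) + m B3)%E.
  by apply: measureU => //; exact: measurableU.
have m3 : m B3 = (tail F (x / 2) * tail F (x / 2))%:E.
  by rewrite EFinM !EFin_tail; exact: product_measure1E.
have := cE; rewrite BE m123 m12 m3 [m B1]measure_sum_left [m B2]measure_sum_right.
rewrite integral_tail_lower//.
set I := (\int[F]_(y in _) _)%E.
have I0 : (0 <= I)%E.
  apply: integral_ge0 => y/=; rewrite in_itv/= => /andP[y0 _].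
  by rewrite lee_fin incr_ge0//; lra.
have /fineK <- : I \is a fin_num.
  rewrite ge0_fin_numE// (@le_lt_trans _ _ (\int[F]_(y in `[0%R, (x / 2)%R]) 1%:E)%E)//.
    apply: ge0_le_integral => //.
    - move=> y/=; rewrite in_itv/= => /andP[y0 _].
      by rewrite lee_fin incr_ge0//; lra.
    - exact: measurable_incr_sub.
    - by move=> y _; rewrite lee_fin (le_trans (incr_le_tail _ _ _))// tail_le1.
  by rewrite integral_cst// mul1e (le_lt_trans (probability_le1 _ _))// ltry.
rewrite -!EFinD => -[->]; congr EFin; by field.
Qed.

End convolution_split.

(** * The integral of the increments *)

Section shifted_increments.
Context {R : realType} (F : probability (measurableTypeR R) R).
Hypothesis F0 : on_nonneg F.
Hypothesis Fm : finite_mean F.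
Hypothesis FL : forall t : R, 0 < t -> local_long_tailed t F.
Let mu := fine (mean F).
Let h x := incr F x (x + 1).

(** For a lower bound it is enough to integrate over bounded [y], where the
    increment is [y * h x] up to a small multiple of [h x]. *)
Lemma integral_incr_ge e : 0 < e -> \forall x \near +oo,
  (((mu - e) * h x)%:E <=
   \int[F]_(y in `[0%R, (x / 2)%R]) (incr F (x - y) x)%:E)%E.
Proof.
move=> e0; have e2 : 0 < e / 2 by rewrite divr_gt0.
have [A /(_ A%:R (lexx _)) cutA] := mean_cut F0 Fm e2.
near=> x.
have xA : A%:R <= x / 2.
  rewrite ler_pdivlMr//; near: x; exact: nbhs_pinfty_ge (num_real _).
have U y : 0 <= y <= A%:R -> `|incr F (x - y) x - y * h x| <= e / 2 * h x.
  by move: y; near: x; exact: incr_uniform_linear.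
have h0 : 0 <= h x := incr1_ge0 _ _.
apply: (@le_trans _ _ (\int[F]_(y in `[0%R, A%:R]) (incr F (x - y) x)%:E)%E); last first.
  apply: ge0_subset_integral => //; first exact: measurable_incr_sub.
    move=> y/=; rewrite in_itv/= => /andP[y0 _].
    by rewrite lee_fin incr_ge0//; lra.
  by move=> y/=; rewrite !in_itv/= => /andP[-> yA]; exact: le_trans xA.
have -> : ((mu - e) * h x)%:E = (((mu - e / 2) * h x)%:E - (e / 2 * h x)%:E)%E.
  by rewrite -EFinB; congr EFin; lra.
rewrite leeBlDr//.
have cE : ((e / 2 * h x)%:E * F `[0%R, A%:R]%classic <= (e / 2 * h x)%:E)%E.
  rewrite measure_itv0// -EFinM lee_fin; apply: ler_piMr.
    by rewrite mulr_ge0// ltW.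
  by rewrite gerBl tail_ge0.
apply: le_trans (leeD2l _ cE).
rewrite -integral_cst// -ge0_integralD//=; last 3 first.
- move=> y/=; rewrite in_itv/= => /andP[y0 _].
  by rewrite lee_fin incr_ge0//; lra.
- exact: measurable_incr_sub.
- by move=> y _; rewrite lee_fin mulr_ge0// ltW.
apply: (@le_trans _ _ ((h x)%:E * \int[F]_(y in `[0%R, A%:R]) y%:E)%E).
  by rewrite mulrC EFinM lee_wpmul2l.
rewrite -ge0_integralZl//; last by move=> y/=; rewrite in_itv/= => /andP[].
apply: ge0_le_integral => //.
- move=> y/=; rewrite in_itv/= => /andP[y0 _].
  by rewrite mule_ge0.
- by apply: measurable_funeM; exact: EFin_measurable.
- by apply: emeasurable_funD => //; exact: measurable_incr_sub.
- move=> y/=; rewrite in_itv/= => yA; rewrite -EFinM -EFinD lee_fin.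
  by have := U _ yA; rewrite ler_norml => /andP[+ _]; lra.
Unshelve. all: by end_near. Qed.

Lemma integral_incr_head_le (A : nat) e : 0 < e -> \forall x \near +oo,
  (\int[F]_(y in `[0%R, A%:R]) (incr F (x - y) x)%:E <=
   ((mu + e) * h x)%:E)%E.
Proof.
move=> e0; near=> x.
have U y : 0 <= y <= A%:R -> `|incr F (x - y) x - y * h x| <= e * h x.
  by move: y; near: x; exact: incr_uniform_linear.
have h0 : 0 <= h x := incr1_ge0 _ _.
have eh0 : 0 <= e * h x by rewrite mulr_ge0// ltW.
apply: (@le_trans _ _
  (\int[F]_(y in `[0%R, A%:R]) ((h x)%:E * y%:E + (e * h x)%:E))%E).
  apply: ge0_le_integral => //.
  - move=> y/=; rewrite in_itv/= => /andP[y0 _].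
    by rewrite lee_fin incr_ge0//; lra.
  - exact: measurable_incr_sub.
  - apply: emeasurable_funD => //; apply: measurable_funeM.
    exact: EFin_measurable.
  - move=> y/=; rewrite in_itv/= => yA; rewrite -EFinM -EFinD lee_fin.
    by have := U _ yA; rewrite ler_norml => /andP[_]; lra.
rewrite ge0_integralD//=; last 2 first.
- by move=> y; rewrite in_itv/= => /andP[y0 _]; rewrite mule_ge0.
- by apply: measurable_funeM; exact: EFin_measurable.
have -> : ((mu + e) * h x)%:E = ((mu * h x)%:E + (e * h x)%:E)%E by rewrite -EFinD mulrDl.
apply: leeD; last first.
  rewrite integral_cst// [X in (_ * X)%E](measure_itv0 F0 (ler0n _ A)) -EFinM lee_fin.
  apply: ler_piMr => //.
  by rewrite gerBl tail_ge0.
rewrite ge0_integralZl//; last by move=> y/=; rewrite in_itv/= => /andP[].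
by rewrite mulrC EFinM lee_wpmul2l// integral_id_le.
Unshelve. all: by end_near. Qed.

Let cellE (k c : R) :
  (fun y : measurableTypeR R => ((k < y)%R%:R * c)%:E) =
  (fun y : measurableTypeR R => c%:E * (\1_(`]k, +oo[%classic) y)%:E)%E.
Proof.
apply/funext => y; have -> : (k < y)%R = (y \in `]k, +oo[%classic).
  by apply/idP/idP; rewrite inE/= in_itv/= andbT.
by rewrite -EFinM mulrC indicE.
Qed.

Let measurable_cell (k c : R) (D : set (measurableTypeR R)) :
  measurable_fun D (fun y : measurableTypeR R => ((k < y)%R%:R * c)%:E).
Proof.
rewrite cellE; apply: measurable_funTS; apply: measurable_funeM.
apply/measurable_EFinP; apply: measurable_indic; exact: measurable_itv.
Qed.

Lemma integral_cell_le (A : R) (b k c : R) : 0 <= c ->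
  (\int[F]_(y in `]A, b]) ((k < y)%R%:R * c)%:E <=
   (tail F (Num.max A k) * c)%:E)%E.
Proof.
move=> c0; rewrite cellE ge0_integralZl//; last first.
  apply: measurable_funTS; apply/measurable_EFinP.
  by apply: measurable_indic; exact: measurable_itv.
rewrite integral_indic//.
have -> : (tail F (Num.max A k) * c)%:E = (c%:E * (tail F (Num.max A k))%:E)%E.
  by rewrite -EFinM mulrC.
rewrite lee_wpmul2l// EFin_tail le_measure ?inE//.
  by apply: measurableI; exact: measurable_itv.
move=> y/=; rewrite !in_itv/= !andbT => -[ky /andP[Ay _]].
by rewrite gt_max Ay.
Qed.

Lemma integral_incr_tail_le_sum (A N : nat) x : x / 2 <= N%:R ->
  (\int[F]_(y in `]A%:R, (x / 2)%R]) (incr F (x - y) x)%:E <=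
   (\sum_(0 <= k < N) tail F (maxn A k)%:R * h (x - k.+1%:R))%:E)%E.
Proof.
move=> xN; apply: (@le_trans _ _ (\int[F]_(y in `]A%:R, (x / 2)%R])
    (\sum_(k < N) ((k%:R < y)%R%:R * h (x - k.+1%:R))%:E))%E).
  apply: ge0_le_integral => //.
  - move=> y/=; rewrite in_itv/= => /andP[y0 _].
    have : 0 <= A%:R :> R by [].
    by move=> ?; rewrite lee_fin incr_ge0//; lra.
  - exact: measurable_incr_sub.
  - by apply: emeasurable_sum => k; exact: measurable_cell.
  - move=> y/=; rewrite in_itv/= => /andP[Ay yx].
    rewrite sumEFin lee_fin incr_le_sum_cells// (le_trans yx)// andbT.
    by rewrite ltW// (le_lt_trans _ Ay).
rewrite ge0_integral_sum//; last first.
  by move=> k y _; rewrite lee_fin mulr_ge0// incr1_ge0.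
rewrite big_mkord -sumEFin; apply: lee_sum => k _.
apply: (le_trans (integral_cell_le _ _ _ (incr1_ge0 _ _))).
by rewrite natr_max.
Qed.

Hypothesis FS : S_star F.
Hypothesis hazard_bounded : exists2 C, 0 <= C &
  \forall x \near +oo, forall z, x / 4 <= z <= x ->
    h z <= C * (h x / tail F x) * tail F z.

(** The heart of the domination argument.  The first [A + 1] cells are within a
    bounded distance of [x], and each weighs about [h x]; their total weight is
    small because [A * tail F A] is.  The weights of the other cells are bounded
    through the hazard rate at [x] by tails, and what remains is the middle part
    of the convolution integral of the tail, negligible with respect to
    [tail F x] for a distribution in S*. *)
Lemma sum_cells_small e : 0 < e -> exists A : nat, \forall x \near +oo,
  \sum_(0 <= k < (Num.truncn (x / 2)).+1)
    tail F (maxn A k)%:R * h (x - k.+1%:R) <= e * h x.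
Proof.
move=> e0; have [C C0 HC] := hazard_bounded.
have C1 : 0 < 8 * (1 + C) by lra.
(* The two groups of cells contribute [4 * d * h x] and [4 * C * d * h x]. *)
pose d := e / (8 * (1 + C)); have d0 : 0 < d by rewrite divr_gt0.
have dE : d * (8 * (1 + C)) = e by rewrite divfK// gt_eqF.
have [A1 A1P] := tail_mul_small F0 Fm d0.
have [A2 A2P] := S_star_middle F0 Fm FS d0.
pose A := maxn 1 (maxn A1 A2).
have A_ge1 : 1 <= A%:R :> R by rewrite ler1n leq_max.
have {A1P}dA : A%:R * tail F A%:R <= d.
  by apply: A1P; rewrite ler_nat !leq_max leqnn !orbT.
have /A2P/near_pinftyP[X0 XP] : A2%:R <= A%:R :> R.
  by rewrite ler_nat !leq_max leqnn !orbT.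
clearbody A.
exists A; near=> x.
have x4 : 4 <= x by near: x; exact: nbhs_pinfty_ge (num_real _).
have xA : 2 * A%:R + 6 <= x by near: x; exact: nbhs_pinfty_ge (num_real _).
have xX : X0 <= x - 2.
  by rewrite lerBrDr; near: x; exact: nbhs_pinfty_ge (num_real _).
have T1 : tail F (x - 1) <= 2 * tail F x by near: x; exact: tail_shift1 (FL ltr01).
have T2 : tail F (x - 2) <= 4 * tail F x.
  have : tail F (x - 1 - 1) <= 2 * tail F (x - 1).
    near: x; have /near_pinftyP[Y YP] := tail_shift1 (FL ltr01).
    by apply/near_pinftyP; exists (Y + 1) => x xY; apply: YP; lra.
  by rewrite (_ : x - 1 - 1 = x - 2); [lra|ring].
have shift z : 0 <= z <= A.+1%:R -> h (x - z) <= (1 + 1) * h x.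
  move=> zA; suff [] : h (x - z) <= (1 + 1) * h x /\ h x <= (1 + 1) * h (x - z) by [].
  move: z zA; near: x; exact: (local_long_tailed_shift ler01 (FL ltr01) A.+1 ltr01).
have hb z : x / 4 <= z <= x -> h z <= C * (h x / tail F x) * tail F z.
  by move: z; near: x.
have hx : 0 < h x by near: x; exact: (local_long_tailed_gt0 ler01 (FL ltr01)).
have Tx : 0 < tail F x by rewrite (lt_le_trans hx)// incr_le_tail.
have MID := XP _ xX.
set N := Num.truncn (x / 2).
have /andP[Nx xN] : N%:R <= x / 2 < N.+1%:R.
  by apply: truncn_itv; lra.
have AN : (A <= N)%N.
  rewrite -ltnS -(ltr_nat R); lra.
rewrite (@big_cat_nat _ _ _ A.+1)//=.
have head : \sum_(0 <= k < A.+1) tail F (maxn A k)%:R * h (x - k.+1%:R)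
    <= 4 * d * h x.
  apply: (@le_trans _ _ (\sum_(0 <= k < A.+1) tail F A%:R * (2 * h x))).
    rewrite !big_mkord; apply: ler_sum => k _.
    have /maxn_idPl -> : (k <= A)%N by rewrite -ltnS.
    rewrite ler_wpM2l ?tail_ge0// shift//.
    by rewrite ler0n ler_nat ltn_ord.
  rewrite big_mkord sumr_const card_ord -[leLHS]mulr_natr -(natr1 A).
  rewrite [leLHS](_ : _ = 2 * (A%:R * tail F A%:R + tail F A%:R) * h x); last by ring.
  rewrite ler_wpM2r ?(ltW hx)//.
  have : tail F A%:R <= A%:R * tail F A%:R by rewrite ler_peMl ?tail_ge0.
  by lra.
have rest : \sum_(A.+1 <= k < N.+1) tail F (maxn A k)%:R * h (x - k.+1%:R)
    <= 4 * C * d * h x.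
  pose c := C * (h x / tail F x).
  have c0 : 0 <= c by rewrite mulr_ge0// divr_ge0// ltW.
  apply: (@le_trans _ _ (\sum_(A.+1 <= k < N.+1)
      c * (tail F k%:R * tail F (x - 2 + 2 - k.+1%:R)))).
    rewrite big_nat_cond [leRHS]big_nat_cond; apply: ler_sum => k.
    rewrite andbT => /andP[Ak kN].
    have /maxn_idPr -> : (A <= k)%N by exact: ltnW.
    rewrite subrK mulrCA ler_wpM2l ?tail_ge0//.
    apply: hb; have : k%:R <= N%:R :> R by rewrite ler_nat.
    have := ler0n R k; rewrite -(natr1 k); move=> ? ?; apply/andP; split; lra.
  rewrite -mulr_sumr.
  have S : \sum_(A.+1 <= k < N.+1) tail F k%:R * tail F (x - 2 + 2 - k.+1%:R)
      <= d * tail F (x - 2).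
    rewrite -lee_fin; apply: le_trans MID.
    apply: (le_trans (sum_tail_tail_le_integral _ _ AN)).
    apply: ge0_subset_integral => //.
    - exact: measurable_tail_mul_tail.
    - by move=> s _; rewrite lee_fin mulr_ge0 ?tail_ge0.
    - move=> s/=; rewrite !in_itv/= => /andP[-> sN].
      by rewrite (le_lt_trans sN)//; lra.
  apply: (le_trans (ler_wpM2l c0 S)).
  rewrite (_ : 4 * C * d * h x = c * (d * (4 * tail F x))); last first.
    by rewrite /c; field; rewrite gt_eqF.
  by rewrite ler_wpM2l// ler_wpM2l// ltW.
apply: (le_trans (lerD head rest)).
by rewrite -dE; nra.
Unshelve. all: by end_near. Qed.
End shifted_increments.

(** * Second order and local subexponentiality *)

Section second_order.
Context {R : realType} (F : probability (measurableTypeR R) R).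
Hypothesis F0 : on_nonneg F.
Hypothesis Fm : finite_mean F.
Hypothesis FL : forall t : R, 0 < t -> local_long_tailed t F.
Let mu := fine (mean F).
Let h x := incr F x (x + 1).
Hypothesis FS : S_star F.
Hypothesis hazard_bounded : exists2 C, 0 <= C &
  \forall x \near +oo, forall z, x / 4 <= z <= x ->
    h z <= C * (h x / tail F x) * tail F z.

(** The part [y <= A] contributes at most about [mu * h x], and the cells cover
    the rest. *)
Lemma integral_incr_le e : 0 < e -> \forall x \near +oo,
  (\int[F]_(y in `[0%R, (x / 2)%R]) (incr F (x - y) x)%:E <=
   ((mu + e) * h x)%:E)%E.
Proof.
move=> e0; have e2 : 0 < e / 2 by rewrite divr_gt0.
have [A HA] := sum_cells_small F0 Fm FL FS hazard_bounded e2.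
near=> x.
have xA : A%:R <= x / 2.
  rewrite ler_pdivlMr//; near: x; exact: nbhs_pinfty_ge (num_real _).
have head : (\int[F]_(y in `[0%R, A%:R]) (incr F (x - y) x)%:E <=
   ((mu + e / 2) * h x)%:E)%E by near: x; exact: integral_incr_head_le.
have rest : (\int[F]_(y in `]A%:R, (x / 2)%R]) (incr F (x - y) x)%:E <=
   (e / 2 * h x)%:E)%E.
  have xN := ltW (truncnS_gt (x / 2)).
  apply: (le_trans (integral_incr_tail_le_sum F A xN)).
  by rewrite lee_fin; near: x.
have -> : ((mu + e) * h x)%:E = (((mu + e / 2) * h x)%:E + (e / 2 * h x)%:E)%E.
  by rewrite -EFinD; congr EFin; lra.
rewrite (@ge0_integral_itv_split _ _ _ _ (BRight A%:R)) ?bnd_simp//.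
- exact: leeD.
- exact: measurable_incr_sub.
- by move=> y; rewrite in_itv/= => /andP[y0 _]; rewrite lee_fin incr_ge0//; lra.
Unshelve. all: by end_near. Qed.

Hypothesis tail_half : asymp_o (fun x : R => tail F (x / 2) ^+ 2) h.

Let excess x := tail (convolution F F) x - 2 * tail F x.

(** The excess is twice the integral of the increments, up to terms that are at
    most [2 * tail F (x / 2) ^+ 2]. *)
Lemma excess_estimate e : 0 < e -> \forall x \near +oo,
  `|excess x - 2 * mu * h x| <= e * h x.
Proof.
move=> e0; have e4 : 0 < e / 4 by rewrite divr_gt0.
have e6 : 0 < e / 6 by rewrite divr_gt0.
near=> x.
have x0 : 0 <= x by near: x; exact: nbhs_pinfty_ge (num_real _).
have hx : 0 < h x by near: x; exact: (local_long_tailed_gt0 ler01 (FL ltr01)).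
have := tail_convolution F0 x0; rewrite -/(excess x).
have : (((mu - e / 4) * h x)%:E <=
   \int[F]_(y in `[0%R, (x / 2)%R]) (incr F (x - y) x)%:E)%E.
  by near: x; exact: integral_incr_ge.
have : (\int[F]_(y in `[0%R, (x / 2)%R]) (incr F (x - y) x)%:E <=
   ((mu + e / 4) * h x)%:E)%E.
  by near: x; exact: integral_incr_le.
move=> + + E; rewrite E !lee_fin => up lo.
have T2 : tail F (x / 2) ^+ 2 <= e / 6 * h x.
  have : `|0 - tail F (x / 2) ^+ 2 / h x| < e / 6.
    by near: x; move/cvgrPdist_lt : tail_half; exact.
  rewrite sub0r normrN ger0_norm ?divr_ge0 ?sqr_ge0 ?(ltW hx)//.
  by rewrite ltr_pdivrMr// => /ltW.
have TT : tail F x * tail F (x / 2) <= tail F (x / 2) ^+ 2.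
  by rewrite expr2 ler_wpM2r ?tail_ge0// tail_nonincreasing//; lra.
have TT0 : 0 <= tail F x * tail F (x / 2) by rewrite mulr_ge0 ?tail_ge0.
have T20 : 0 <= tail F (x / 2) ^+ 2 by rewrite sqr_ge0.
by rewrite ler_norml; apply/andP; split; lra.
Unshelve. all: by end_near. Qed.

Lemma mean_gt0 : 0 < mu.
Proof.
have /near_pinftyP[X XP] := local_long_tailed_gt0 ler01 (FL ltr01).
pose B := Num.max X 1.
have B0 : 0 < B by rewrite lt_max ltr01 orbT.
have TB : 0 < tail F B.
  by apply: lt_le_trans (incr_le_tail F B (B + 1)); apply: XP; rewrite le_max lexx.
have BT : 0 < B * tail F B by rewrite mulr_gt0.
rewrite (lt_le_trans BT)// -lee_fin; apply: le_trans (integral_id_itv_le F0 Fm (ltW B0)).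
by rewrite leeDr// integral_ge0// => y/=; rewrite in_itv/= lee_fin => /andP[].
Qed.

Lemma second_order_tail :
  asymp_eq excess (fun x => 2 * mu * incr F x (x + 1)).
Proof.
have mu0 := mean_gt0.
apply/cvgrPdist_le => e e0; near=> x.
have hx : 0 < h x by near: x; exact: (local_long_tailed_gt0 ler01 (FL ltr01)).
have c0 : 0 < 2 * mu * h x by rewrite !mulr_gt0.
have -> : 1 - excess x / (2 * mu * h x) = - (excess x - 2 * mu * h x) / (2 * mu * h x).
  by rewrite opprB [RHS]mulrBl divff ?gt_eqF.
rewrite normrM normrN normfV (gtr0_norm c0) ler_pdivrMr//.
have -> : e * (2 * mu * h x) = (e * (2 * mu)) * h x by ring.
near: x; apply: excess_estimate; by rewrite !mulr_gt0.
Unshelve. all: by end_near. Qed.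

(** The local asymptotics of the convolution is the difference of its second
    order expansions at [x] and [x + t], whose main terms cancel. *)
Lemma local_subexponential_of_second_order (t : R) : 0 < t ->
  local_subexponential t F.
Proof.
move=> t0; split; first exact: FL.
have mu0 := mean_gt0.
apply/cvgrPdist_le => e e0.
(* The difference of the expansions is at most [(3 + 4 * mu) * d * h (x + t)],
   and the mass of ]x, x + t] is at least [t / 2 * h (x + t)]. *)
pose d := Num.min 1 (t * e / (3 + 4 * mu)).
have M0 : 0 < 3 + 4 * mu by lra.
have d0 : 0 < d by rewrite lt_min ltr01 divr_gt0// mulr_gt0.
have d1 : d <= 1 by rewrite ge_min lexx.
have de : (3 + 4 * mu) * d <= t * e.
  by rewrite mulrC -ler_pdivlMr// ge_min lexx orbT.
pose A := (Num.truncn t).+1.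
have tA : t <= A%:R by rewrite ltW// truncnS_gt.
have t2 : 0 < t / 2 by rewrite divr_gt0.
have /near_pinftyP[X1 P1] := local_long_tailed_shift ler01 (FL ltr01) A d0.
have /near_pinftyP[X2 P2] := incr_uniform_linear FL A t2.
have /near_pinftyP[X3 P3] := excess_estimate d0.
have /near_pinftyP[X4 P4] := local_long_tailed_gt0 ler01 (FL ltr01).
apply/near_pinftyP; exists (Num.max X1 (Num.max X2 (Num.max X3 X4))) => x.
rewrite !ge_max => /and4P[x1 x2 x3 x4].
have [||] := P1 (x + t) _ t; [by lra|by lra|]; rewrite addrK -!/(h _) => h1 h2.
have := P2 (x + t) _ t; rewrite addrK -/(h _) => /(_ _ _) h3.
have {h3} : `|incr F x (x + t) - t * h (x + t)| <= t / 2 * h (x + t).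
  by apply: h3; lra.
rewrite ler_norml => /andP[h3 _].
have := P3 _ x3; rewrite ler_norml => /andP[h4 h5].
have xt : X3 <= x + t by lra.
have := P3 _ xt; rewrite ler_norml => /andP[h6 h7].
have h8 : 0 < h (x + t) by apply: P4; lra.
set c := incr F x (x + t) in h3 *.
have c0 : 0 < c.
  have : 0 < t / 2 * h (x + t) by rewrite mulr_gt0.
  by lra.
have -> : incr (convolution F F) x (x + t) = excess x - excess (x + t) + 2 * c.
  by rewrite /excess /c !incr_tail; ring.
have -> : 1 - (excess x - excess (x + t) + 2 * c) / (2 * c) =
    - (excess x - excess (x + t)) / (2 * c).
  by field; rewrite gt_eqF.
rewrite normrM normrN normfV (@gtr0_norm _ (2 * c)) ?mulr_gt0//.
rewrite ler_pdivrMr ?mulr_gt0//.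
pose H := h (x + t); rewrite -/H in h1 h2 h3 h6 h7 h8.
have dH : d * H <= H by rewrite ler_piMl// ltW.
have dh : d * h x <= 2 * (d * H).
  have := ler_wpM2l (ltW d0) h1.
  have : d * (d * H) <= d * H by rewrite ler_wpM2l// ltW.
  by lra.
have muH1 : mu * (h x - H) <= mu * (2 * (d * H)) by rewrite ler_wpM2l ?(ltW mu0)//; lra.
have muH2 : mu * (H - h x) <= mu * (2 * (d * H)) by rewrite ler_wpM2l ?(ltW mu0)//; lra.
have : `|excess x - excess (x + t)| <= (3 + 4 * mu) * d * H.
  by rewrite ler_norml; apply/andP; split; lra.
move=> /le_trans; apply.
apply: (@le_trans _ _ (t * e * H)); first by rewrite ler_wpM2r// ltW.
have -> : t * e * H = e * (2 * (t / 2 * H)) by field.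
by rewrite ler_wpM2l ?(ltW e0)//; lra.
Qed.

End second_order.

Theorem proposition4 (R : realType) (F : probability (measurableTypeR R) R)
    (h := fun x : R => incr F x (x + 1))
    (q := fun x : R => h x / tail F x) :
  on_nonneg F ->
  (forall t : R, 0 < t -> local_long_tailed t F) ->
  finite_mean F ->
  S_star F ->
  asymp_o (fun x : R => tail F (x / 2) ^+ 2) h ->
  (forall y : R, 0 < y ->
    (limf_esup (fun x : R => (q (x * y) / q x)%:E) (pinfty_nbhs R) < +oo)%E) ->
  second_order_subexponential F.
Proof.
move=> F0 FL Fm FS Fh Fq.
have hazard := incr1_hazard_bound (FL _ ltr01) Fq.
split => //.
- by move=> t t0; apply: local_subexponential_of_second_order.
- exact: second_order_tail.
Qed.
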